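(* Let $\frac12<\sigma<1$, $r\ge2$, $\boldsymbol\theta\in\mathbb{R}^r$, and let $\boldsymbol\chi=(\chi_1,\dots,\chi_r)$ be an $r$-tuple of pairwise inequivalent Dirichlet characters. There is $\alpha_0(\sigma,r)$, depending only on $\sigma$ and $r$, such that for $\boldsymbol\alpha=(\alpha,1,\dots,1)\in\mathbb{R}^r$ with $\alpha\ge\alpha_0(\sigma,r)$, we have $\Xi_j(\sigma,\boldsymbol\chi,\boldsymbol\theta;\boldsymbol\alpha)>0$ for all $1\le j\le r$ and $$\xi(\sigma,\boldsymbol\chi,\boldsymbol\theta;\boldsymbol\alpha)>\sum_{j=1}^r\Xi_j(\sigma,\boldsymbol\chi,\boldsymbol\theta;\boldsymbol\alpha)^{\frac1{1-\sigma}}.$$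
   Context: Two Dirichlet characters are equivalent if they are induced by the same primitive character. Let $d$ be the least common multiple of the moduli of $\chi_1,\dots,\chi_r$ and $\phi$ the Euler totient function. For $\boldsymbol\alpha=(\alpha_1,\dots,\alpha_r)\in(\mathbb{R}_{>0})^r$, $$\xi(\sigma,\boldsymbol\chi,\boldsymbol\theta;\boldsymbol\alpha)=\frac1{\phi(d)}\sum_{u\in(\mathbb{Z}/d\mathbb{Z})^\times}\Bigl|\sum_{j=1}^r\alpha_je^{-i\theta_j}\chi_j(u)\Bigr|^{1/\sigma},$$ $$\Xi_j(\sigma,\boldsymbol\chi,\boldsymbol\theta;\boldsymbol\alpha)=\frac1{\phi(d)}\sum^{*}_{u\in(\mathbb{Z}/d\mathbb{Z})^\times}\Bigl|\sum_{\ell=1}^r\alpha_\ell e^{-i\theta_\ell}\chi_\ell(u)\Bigr|^{\frac1\sigma-2}\operatorname{Re}\Bigl(\overline{e^{-i\theta_j}\chi_j(u)}\sum_{k=1}^r\alpha_ke^{-i\theta_k}\chi_k(u)\Bigr),$$ where $\sum^*$ means the sum is over those $u$ with $\sum_{\ell=1}^r\alpha_\ell e^{-i\theta_\ell}\chi_\ell(u)\ne0$. *)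

(* Defs.v *)
From mathcomp Require Export all_boot all_order all_algebra.
From mathcomp Require Export reals exp trigo.
From mathcomp Require Export complex.

Set Implicit Arguments.
Unset Strict Implicit.
Unset Printing Implicit Defensive.

Import Order.TTheory GRing.Theory Num.Theory.

Local Open Scope ring_scope.

(* A Dirichlet character as a function on the integers, bundled with its
   modulus.  [dchar 1 = 1] follows from [dchar_eq0] and [dcharM]. *)
Record dirichlet_char (R : realType) := DirichletChar {
  modulus : nat;
  dchar :> int -> R[i];
  modulus_gt0 : (0 < modulus)%N;
  dcharM : forall m n : int, dchar (m * n) = dchar m * dchar n;
  dchar_periodic : forall n : int, dchar (n + modulus%:Z) = dchar n;
  dchar_eq0 : forall n : int, (dchar n == 0) = ~~ coprimez n modulus%:Z }.

Definition induced_by (R : realType) (chi psi : dirichlet_char R) : Prop :=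
  (modulus psi %| modulus chi)%N /\
  forall n : int, coprimez n (modulus chi)%:Z -> chi n = psi n.

Definition primitive_char (R : realType) (chi : dirichlet_char R) : Prop :=
  forall psi : dirichlet_char R, induced_by chi psi -> modulus psi = modulus chi.

Definition equivalent_chars (R : realType) (chi1 chi2 : dirichlet_char R) : Prop :=
  exists psi : dirichlet_char R,
    [/\ primitive_char psi, induced_by chi1 psi & induced_by chi2 psi].

Definition lcm_moduli (R : realType) (r : nat)
    (chi : 'I_r -> dirichlet_char R) : nat :=
  \big[lcmn/1%N]_(j < r) modulus (chi j).

(* exp (- i t) *)
Definition expNi (R : realType) (t : R) : R[i] := (cos t -i* sin t)%C.

Definition twisted_sum (R : realType) (r : nat) (chi : 'I_r -> dirichlet_char R)
    (theta alpha : 'I_r -> R) (u : int) : R[i] :=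
  \sum_(j < r) (alpha j)%:C%C * expNi (theta j) * chi j u.

Definition cmod (R : realType) (z : R[i]) : R := complex.Re `|z|.

(* The group of units of Z/dZ is enumerated by the residues [0 <= u < d] coprime
   to [d]; for [d = 1] this is the single residue 0. *)
Definition xi (R : realType) (r : nat) (sigma : R)
    (chi : 'I_r -> dirichlet_char R) (theta alpha : 'I_r -> R) : R :=
  let d := lcm_moduli chi in
  (totient d)%:R^-1 *
  \sum_(u < d | coprime u d)
     cmod (twisted_sum chi theta alpha u%:Z) `^ (1 / sigma).

Definition Xi (R : realType) (r : nat) (sigma : R)
    (chi : 'I_r -> dirichlet_char R) (theta alpha : 'I_r -> R) (j : 'I_r) : R :=
  let d := lcm_moduli chi in
  (totient d)%:R^-1 *
  \sum_(u < d | coprime u d && (twisted_sum chi theta alpha u%:Z != 0))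
     cmod (twisted_sum chi theta alpha u%:Z) `^ (1 / sigma - 2) *
     complex.Re ((expNi (theta j) * chi j u%:Z)^*%C *
                 twisted_sum chi theta alpha u%:Z).

Definition alpha_vec (R : realType) (r : nat) (alpha : R) : 'I_r -> R :=
  fun j => if val j == 0%N then alpha else 1.

(* Main.v *)
(* Put [p = 1 / sigma], so [1 < p < 2], and write the twisted sum as
   [S = alpha a_0 + sum_(j != 0) a_j] with [|a_j| = 1].  Since
   [|S|^2 = sum_j alpha_j Re (conj a_j S)], one has
   [xi = alpha Xi_0 + sum_(j != 0) Xi_j]; with [1 / (1 - sigma) = p / (p - 1)]
   it therefore suffices that [0 < Xi_0 <= alpha^(p - 1)] and [0 < Xi_j < 1] for
   [j != 0].  Rotating by [conj a_0] gives [w_j = conj a_0 a_j], whose mean over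
   the units vanishes for [j != 0].  The first bound follows from concavity of
   [t^(p - 1)].  For the second one, a first-order expansion of [|S|^(p - 2)] gives
   [Xi_j = alpha^(p - 2) (1 + (p - 2) E_j + O(1 / alpha))] where, by orthogonality
   of inequivalent characters, [E_j], the mean of
   [Re (sum_(k != 0) w_k) Re w_j], is at most 1. *)

From mathcomp Require Import cyclic boolp ring lra.
Require Import Defs.

Set Implicit Arguments.
Unset Strict Implicit.
Unset Printing Implicit Defensive.

Import Order.TTheory GRing.Theory Num.Theory.

Local Open Scope ring_scope.

(** * Coprime lifts of residues *)

Lemma coprimez_primes (a : int) (d : nat) : (0 < d)%N ->
  (forall p : nat, prime p -> (p%:Z %| a)%Z -> ~~ (p %| d)%N) ->
  coprimez a d%:Z.
Proof.
move=> d_gt0 h; rewrite coprimezE /coprime /=; apply/negPn/negP => g1.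
have g2 : (1 < gcdn `|a| d)%N by rewrite ltn_neqAle eq_sym g1 gcdn_gt0 d_gt0 orbT.
have gd := pdiv_dvd (gcdn `|a| d).
have /negP := h _ (pdiv_prime g2) (dvdn_trans gd (dvdn_gcdl _ _)); apply.
exact: dvdn_trans gd (dvdn_gcdr _ _).
Qed.

Lemma coprimez_prime_ndvd (p m : nat) (a : int) : prime p ->
  (p%:Z %| a)%Z -> coprimez a m%:Z -> ~~ (p %| m)%N.
Proof.
move=> pp pa; apply: contraL => pm; apply/negP => /eqP /= gab.
have : (p %| gcdn `|a| m)%N by rewrite dvdn_gcd; apply/andP.
by move: gab; rewrite /gcdz => -[->]; rewrite dvdn1 => /eqP p1; rewrite p1 in pp.
Qed.

(* [shift m d n] is congruent to [n] mod [m], and coprime to [d] as soon as [n]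
   is coprime to [m]: a prime divisor of [d] divides exactly one of [n] and
   [shift m d n - n]. *)
Definition shift (m d : nat) (n : int) : int :=
  n + m%:Z * (\prod_(p <- primes d | ~~ (p%:Z %| n)%Z) p)%N%:Z.

Lemma coprimez_shift (m d : nat) (n : int) :
  (0 < d)%N -> coprimez n m%:Z -> coprimez (shift m d n) d%:Z.
Proof.
move=> d_gt0 cnm; apply: coprimez_primes => // p pp; apply: contraL => pd.
rewrite /shift; set t := (\prod_(q <- _ | _) q)%N.
have [pn|pn] := boolP (p%:Z %| n)%Z.
  rewrite (rpredDl _ pn) dvdzE abszM /= Euclid_dvdM // negb_or.
  rewrite (coprimez_prime_ndvd pp pn cnm) /t.
  apply/negP; rewrite (big_morph _ (id1 := false) (fun x y => Euclid_dvdM x y pp));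
    last by rewrite Euclid_dvd1.
  rewrite big_has_cond => /hasP[q qd /andP[qn]].
  rewrite dvdn_prime2 //; last by move: qd; rewrite mem_primes => /andP[].
  by move=> /eqP pq; rewrite -pq pn in qn.
have pt : (p%:Z %| m%:Z * t%:Z)%Z.
  rewrite dvdzE abszM dvdn_mull //= /t (big_rem p) /=.
    by rewrite pn dvdn_mulr.
  by rewrite mem_primes pp d_gt0.
by rewrite (rpredDr _ pt).
Qed.

Lemma dvdz_shift (m d : nat) (n : int) : (m%:Z %| shift m d n - n)%Z.
Proof. by rewrite /shift [n + _]addrC addrK dvdz_mulr. Qed.

Lemma coprimez_congr (m : nat) (a b : int) :
  (m%:Z %| a - b)%Z -> coprimez a m%:Z = coprimez b m%:Z.
Proof.
move=> /dvdzP[q e]; have -> : a = q * m%:Z + b by rewrite -e subrK.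
by rewrite /coprimez gcdzC gcdzMDl gcdzC.
Qed.

(** * Dirichlet characters, induction and equivalence *)

Section Characters.
Variable R : realType.
Implicit Types chi psi : dirichlet_char R.

Lemma dchar_congr chi (a b : int) :
  ((modulus chi)%:Z %| a - b)%Z -> chi a = chi b.
Proof.
have per n (k : nat) : chi (n + k%:Z * (modulus chi)%:Z) = chi n.
  elim: k => [|k IHk]; first by rewrite mul0r addr0.
  by rewrite -addn1 PoszD mulrDl mul1r addrA dchar_periodic.
move=> /dvdzP[q e]; have -> : a = b + q * (modulus chi)%:Z by rewrite -e addrC subrK.
case: q {e} => k; first exact: per.
rewrite NegzE -(per (b + - _ * _) k.+1); congr (chi _); ring.
Qed.

Lemma dchar_coprime_neq0 chi (n : int) :
  coprimez n (modulus chi)%:Z -> chi n != 0.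
Proof. by move=> c; rewrite dchar_eq0 c. Qed.

Lemma dchar1 chi : chi 1 = 1.
Proof.
have c1 : chi 1 != 0 by apply: dchar_coprime_neq0; rewrite coprimezE /= coprime1n.
by apply: (mulIf c1); rewrite mul1r -dcharM mulr1.
Qed.

Lemma dcharX chi (n : int) k : chi (n ^+ k) = chi n ^+ k.
Proof. by elim: k => [|k IHk]; rewrite ?expr0 ?dchar1 // !exprS dcharM IHk. Qed.

(** By Euler's theorem [chi u] is a root of unity, of order dividing [totient (modulus chi)]. *)
Lemma norm_dchar chi (u : nat) : coprime u (modulus chi) -> `|chi u%:Z| = 1.
Proof.
move=> cu; have tot0 : (0 < totient (modulus chi))%N by rewrite totient_gt0 modulus_gt0.
apply/eqP; rewrite -(pexpr_eq1 tot0) // -normrX -dcharX.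
rewrite -[1 in eqbRHS]normr1 -(dchar1 chi).
apply/eqP; congr `| _ |; have e := Euler_exp_totient cu.
by apply: dchar_congr; rewrite -eqz_mod_dvd -[u%:Z]natz -natrX natz modz_nat (modz_nat 1) e.
Qed.

Lemma induced_by_trans chi psi psi' :
  induced_by chi psi -> induced_by psi psi' -> induced_by chi psi'.
Proof.
move=> [d1 h1] [d2 h2]; split=> [|n cn]; first exact: dvdn_trans d2 d1.
by rewrite h1 // h2 //; apply: coprimez_dvdr d1 cn.
Qed.

(** Strong induction on the modulus: a character that is not primitive is induced by one of strictly
    smaller modulus, and induction of characters is transitive. *)
Lemma primitive_exists chi : exists2 psi, primitive_char psi & induced_by chi psi.
Proof.
have [n] := ubnP (modulus chi); elim: n chi => // n IHn chi; rewrite ltnS => le_n.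
have [pr|/existsNP[psi /not_implyP[ind ne]]] := pselect (primitive_char chi).
  by exists chi.
have lt : (modulus psi < modulus chi)%N.
  by rewrite ltn_neqAle dvdn_leq ?modulus_gt0 // ?andbT; [exact/eqP|case: ind].
have [psi' pr ind'] := IHn psi (leq_trans lt le_n).
by exists psi' => //; apply: induced_by_trans ind ind'.
Qed.

(* The common character is obtained modulo [gcdn m1 m2]: its value at [n] is the
   common value of [chi1] and [chi2] at any lift of [n] that is coprime to [d]. *)
Lemma induced_by_common chi1 chi2 (d : nat) : (0 < d)%N ->
  (modulus chi1 %| d)%N -> (modulus chi2 %| d)%N ->
  (forall n : int, coprimez n d%:Z -> chi1 n = chi2 n) ->
  exists2 psi, induced_by chi1 psi & induced_by chi2 psi.
Proof.
move=> d_gt0; set m1 := modulus chi1; set m2 := modulus chi2 => m1d m2d eq12.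
pose g := gcdn m1 m2.
have g_gt0 : (0 < g)%N by rewrite gcdn_gt0 modulus_gt0.
have gd : (g %| d)%N by apply: dvdn_trans m1d; apply: dvdn_gcdl.
have chi1E (a b : int) : coprimez a d%:Z -> coprimez b d%:Z ->
    (g%:Z %| a - b)%Z -> chi1 a = chi1 b.
  move=> ca cb /dvdzP[q eab].
  have [x [y exy]] := Bezoutz m1%:Z m2%:Z; rewrite -[gcdz _ _]/(g%:Z) in exy.
  (* Chinese remaindering for possibly non-coprime moduli: as [a] and [b] agree modulo the gcd,
     Bezout gives [N0] congruent to [a] mod [m1] and to [b] mod [m2]. Its shift [N] is moreover
     coprime to [d], whence [chi1 a = chi1 N = chi2 N = chi2 b = chi1 b]. *)
  pose N0 := b + q * y * m2%:Z.
  have N0a : (m1%:Z %| a - N0)%Z.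
    apply/dvdzP; exists (q * x); rewrite /N0 opprD addrA eab -exy; ring.
  have N0b : (m2%:Z %| N0 - b)%Z by rewrite /N0 addrC addKr dvdz_mull.
  pose N := shift (m1 * m2) d N0.
  have NN0 := dvdz_shift (m1 * m2) d N0.
  have cN : coprimez N d%:Z.
    apply: coprimez_shift => //; rewrite PoszM coprimezMr -(coprimez_congr N0a).
    by rewrite (coprimez_congr N0b) (coprimez_dvdr m1d ca) (coprimez_dvdr m2d cb).
  have aN : (m1%:Z %| a - N)%Z.
    rewrite -(subrK N0 a) -addrA rpredD // -opprB rpredN.
    by apply: dvdz_trans NN0; rewrite PoszM dvdz_mulr.
  have Nb : (m2%:Z %| N - b)%Z.
    rewrite -(subrK N0 N) -addrA rpredD //.
    by apply: dvdz_trans NN0; rewrite PoszM dvdz_mull.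
  by rewrite (dchar_congr aN) eq12 // (dchar_congr Nb) -eq12.
pose f (n : int) := if coprimez n g%:Z then chi1 (shift g d n) else 0.
have fE (n a : int) : coprimez n g%:Z -> coprimez a d%:Z -> (g%:Z %| n - a)%Z ->
    f n = chi1 a.
  move=> cn ca na; rewrite /f cn; apply: chi1E => //.
    exact: coprimez_shift.
  by rewrite -(subrK n (shift _ _ _)) -addrA rpredD // dvdz_shift.
have fM (m n : int) : f (m * n) = f m * f n.
  have [cm|cm] := boolP (coprimez m g%:Z); last first.
    by rewrite /f coprimezMl (negbTE cm) mul0r.
  have [cn|cn] := boolP (coprimez n g%:Z); last first.
    by rewrite /f coprimezMl (negbTE cn) andbF mulr0.
  (* The product of the two lifts is itself an admissible lift of [m * n]. *)
  rewrite (fE _ (shift g d m * shift g d n)) ?coprimezMl ?cm ?cn //.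
  - by rewrite dcharM /f cm cn.
  - by rewrite !coprimez_shift.
  have -> : m * n - shift g d m * shift g d n =
    - (m * (shift g d n - n) + shift g d n * (shift g d m - m)) by ring.
  by rewrite rpredN rpredD // dvdz_mull // dvdz_shift.
have fP (n : int) : f (n + g%:Z) = f n.
  have e : coprimez (n + g%:Z) g%:Z = coprimez n g%:Z.
    by apply: coprimez_congr; rewrite addrC addKr.
  have [cn|cn] := boolP (coprimez n g%:Z); last by rewrite /f e (negbTE cn).
  rewrite (fE n (shift g d (n + g%:Z))) ?coprimez_shift ?e //.
    by rewrite /f e cn.
  have -> : n - shift g d (n + g%:Z) =
    - (g%:Z + (shift g d (n + g%:Z) - (n + g%:Z))) by ring.
  by rewrite rpredN rpredD // dvdz_shift.
have f0 (n : int) : (f n == 0) = ~~ coprimez n g%:Z.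
  rewrite /f; case: ifP => cn; last by rewrite eqxx.
  apply/negbTE/dchar_coprime_neq0; apply: coprimez_dvdr m1d _.
  exact: coprimez_shift.
exists (DirichletChar g_gt0 fM fP f0); split => /=; rewrite ?dvdn_gcdl ?dvdn_gcdr //.
  move=> n cn; have cn' : coprimez n g%:Z := coprimez_dvdr (dvdn_gcdl _ _) cn.
  (* Lifting modulo [m1] rather than [g] keeps the value of [chi1] at [n]; the lift is still
     admissible for [f] because [g] divides [m1]. *)
  have nN := dvdz_shift m1 d n.
  rewrite (fE n (shift m1 d n)) ?coprimez_shift //.
    by apply/esym/dchar_congr.
  rewrite -opprB rpredN; apply: dvdz_trans nN; exact: dvdn_gcdl.
move=> n cn; have cn' : coprimez n g%:Z := coprimez_dvdr (dvdn_gcdr _ _) cn.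
have nN := dvdz_shift m2 d n.
rewrite (fE n (shift m2 d n)) ?coprimez_shift //.
  by rewrite eq12 ?coprimez_shift //; apply/esym/dchar_congr.
rewrite -opprB rpredN; apply: dvdz_trans nN; exact: dvdn_gcdr.
Qed.

(** Reduction modulo [d] extends the agreement to all integers coprime to [d]. The two characters
    are then induced by a common one, hence by a primitive character inducing that one. *)
Lemma equivalent_charsP chi1 chi2 (d : nat) : (0 < d)%N ->
  (modulus chi1 %| d)%N -> (modulus chi2 %| d)%N ->
  (forall n : nat, coprime n d -> chi1 n%:Z = chi2 n%:Z) ->
  equivalent_chars chi1 chi2.
Proof.
move=> d_gt0 m1d m2d eq12.
have [|psi ind1 ind2] := induced_by_common d_gt0 m1d m2d.
  move=> n cn; have nd : (d%:Z %| n - (n %% d%:Z)%Z)%Z.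
    by rewrite [X in X - _](divz_eq n d%:Z) addrK dvdz_mull.
  have d0 : d%:Z != 0 by rewrite eqz_nat -lt0n.
  have [k nk] : exists k : nat, (n %% d%:Z)%Z = k%:Z.
    by exists `|(n %% d%:Z)%Z|%N; rewrite gez0_abs // modz_ge0.
  rewrite nk in nd; rewrite (coprimez_congr nd) in cn.
  rewrite (@dchar_congr chi1 n k) ?(@dchar_congr chi2 n k) ?eq12 //.
    by apply: dvdz_trans nd.
  by apply: dvdz_trans nd.
have [psi' pr ind] := primitive_exists psi.
by exists psi'; split => //; apply: induced_by_trans ind.
Qed.

End Characters.

(** * Tangent bounds for real powers *)

Section RealPowers.
Variable R : realType.
Implicit Types a q t x y z e m : R.

(** Weighted form of [ln x <= x - 1]: with [m] the right-hand side, apply it to [t / m] and [1 / m]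
    with weights [a] and [1 - a]; the weighted upper bounds add up to 0, so [a * ln t <= ln m]. *)
Lemma powR_le_tangent a t : 0 <= a <= 1 -> 0 < t -> t `^ a <= 1 + a * (t - 1).
Proof.
move=> /andP[a0 a1] t0; set m := 1 + _.
have m0 : 0 < m.
  rewrite /m; have [->|an1] := eqVneq a 1; first by lra.
  have : a < 1 by rewrite lt_neqAle an1.
  by nra.
rewrite /powR gt_eqF // -[leRHS]lnK // ler_expR.
have h x : 0 < x -> ln x <= x - 1.
  by move=> x0; have := @le_ln1Dx _ (x - 1); rewrite [1 + _]addrC subrK; apply; lra.
have h1 := h _ (divr_gt0 t0 m0); have := h _ (divr_gt0 ltr01 m0).
rewrite !ln_div ?posrE // in h1 *; rewrite ln1 sub0r => h2.
have h3 := ler_wpM2l a0 h1.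
have b0 : 0 <= 1 - a by lra.
have h4 := ler_wpM2l b0 h2.
have : a * (t / m - 1) + (1 - a) * (1 / m - 1) = 0.
  by rewrite /m; field; apply: lt0r_neq0.
by lra.
Qed.

(** The tangent bound for the exponent [- q] bounds the reciprocal by [1 - q * y], and
    [(1 + q * y) * (1 - q * y) <= 1]. *)
Lemma powR_neg_ge q y : -1 <= q <= 0 -> -1 < y -> 1 + q * y <= (1 + y) `^ q.
Proof.
move=> q01 y1; have y0 : 0 < 1 + y by lra.
have h := @powR_le_tangent (- q) (1 + y) ltac:(lra) y0.
rewrite -[q in leRHS]opprK powRN; have f0 := powR_gt0 (- q) y0.
set f := _ `^ _ in h f0 *; rewrite -[f^-1]mul1r ler_pdivlMr //.
have [y2|/ltW y2] := leP 0 (1 + q * y); last by nra.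
have := ler_wpM2l y2 h; have := sqr_ge0 (q * y); lra.
Qed.

(** This is the tangent bound at the point [(1 + y)^-1] with exponent [- q]. *)
Lemma powR_neg_le q y : -1 <= q <= 0 -> -1 < y ->
  (1 + y) `^ q <= 1 + q * (y / (1 + y)).
Proof.
move=> q01 y1; have y0 : 0 < 1 + y by lra.
have yi : 0 < (1 + y)^-1 by rewrite invr_gt0.
have := @powR_le_tangent (- q) (1 + y)^-1 ltac:(lra) yi.
have -> : (1 + y)^-1 `^ (- q) = (1 + y) `^ q.
  by rewrite -powR_inv1 ?ltW // -powRrM mulrNN mul1r.
suff -> : - q * ((1 + y)^-1 - 1) = q * (y / (1 + y)) by [].
by field; lra.
Qed.

(** Here [m] is the modulus of [1 + x + i z]. Writing [m ^+ 2 = 1 + y], the two previous bounds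
    enclose the power between [1 + q * y] and that value minus [q * (y ^+ 2 / (1 + y))]. The latter
    correction is at most [9 * e ^+ 2], and the quadratic part of [q * y] at most [e ^+ 2], in
    absolute value. *)
Lemma norm_powR_expansion q x z e m :
  - (1 / 2) <= q <= 0 -> 0 <= e <= 1 / 8 -> `|x| <= e -> `|z| <= e ->
  0 <= m -> m ^+ 2 = (1 + x) ^+ 2 + z ^+ 2 ->
  `|m `^ (2 * q) - (1 + 2 * q * x)| <= 10 * e ^+ 2.
Proof.
move=> q0 e0; rewrite !ler_norml => xe ze m0 m2.
have e20 := sqr_ge0 e.
have x2e : x ^+ 2 <= e ^+ 2 by nra.
have z2e : z ^+ 2 <= e ^+ 2 by nra.
have ee : e ^+ 2 <= e / 8 by nra.
have x20 := sqr_ge0 x; have z20 := sqr_ge0 z.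
pose y := 2 * x + (x ^+ 2 + z ^+ 2).
have y3e : - (3 * e) <= y <= 3 * e by rewrite /y; lra.
have y1 : 5 / 8 <= 1 + y by lra.
have y2 : y ^+ 2 <= 9 * e ^+ 2 by nra.
rewrite powRrM powR_mulrn // m2.
have -> : (1 + x) ^+ 2 + z ^+ 2 = 1 + y by rewrite /y; ring.
have lo := @powR_neg_ge q y ltac:(lra) ltac:(lra).
have up := @powR_neg_le q y ltac:(lra) ltac:(lra).
have ey : q * (y / (1 + y)) = q * y - q * (y ^+ 2 / (1 + y)) by field; lra.
have yy0 : 0 <= y ^+ 2 / (1 + y) by rewrite divr_ge0 ?sqr_ge0 //; lra.
have yy : y ^+ 2 / (1 + y) <= 18 * e ^+ 2.
  by rewrite ler_pdivrMr; [nra|lra].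
rewrite ey in up; set w := y ^+ 2 / (1 + y) in up yy yy0.
have qw : - (9 * e ^+ 2) <= q * w by nra.
have qxz : - e ^+ 2 <= q * (x ^+ 2 + z ^+ 2) <= 0 by apply/andP; split; nra.
have eqy : q * y = 2 * q * x + q * (x ^+ 2 + z ^+ 2) by rewrite /y; ring.
by lra.
Qed.

End RealPowers.

(** * Averages over a finite set *)

Section Average.
Variables (R : realType) (T : finType) (P : pred T).
Implicit Types f g : T -> R.

Definition avg f : R := #|P|%:R^-1 * \sum_(u | P u) f u.

Lemma eq_avg f g : (forall u, P u -> f u = g u) -> avg f = avg g.
Proof. by move=> fg; rewrite /avg; congr (_ * _); apply: eq_bigr. Qed.

Lemma avgD f g : avg (fun u => f u + g u) = avg f + avg g.
Proof. by rewrite /avg big_split mulrDr. Qed.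

Lemma avgZ a f : avg (fun u => a * f u) = a * avg f.
Proof. by rewrite /avg -mulr_sumr mulrCA. Qed.

Lemma avg_sum (J : finType) (Q : pred J) (F : J -> T -> R) :
  avg (fun u => \sum_(j | Q j) F j u) = \sum_(j | Q j) avg (F j).
Proof. by rewrite /avg exchange_big /= mulr_sumr. Qed.

Lemma le_avg f g : (forall u, P u -> f u <= g u) -> avg f <= avg g.
Proof.
by move=> fg; rewrite /avg ler_wpM2l ?invr_ge0 ?ler0n //; apply: ler_sum.
Qed.

Hypothesis P_gt0 : (0 < #|P|)%N.

Lemma avg_cst a : avg (fun=> a) = a.
Proof.
rewrite /avg sumr_const -[RHS]mulr1 -[a *+ _]mulr_natr mulrCA mulVf //.
by rewrite pnatr_eq0 -lt0n.
Qed.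

Lemma avg_gt0 f : (forall u, P u -> 0 < f u) -> 0 < avg f.
Proof.
move=> f0; rewrite /avg mulr_gt0 ?invr_gt0 ?ltr0n //.
have /card_gt0P[u Pu] := P_gt0.
rewrite (bigD1 u) //= ltr_pwDl ?f0 // sumr_ge0 // => v /andP[Pv _].
exact/ltW/f0.
Qed.

Lemma avg_dist f g (e : R) :
  (forall u, P u -> `|f u - g u| <= e) -> `|avg f - avg g| <= e.
Proof.
have half f' g' : (forall u, P u -> f' u <= g' u + e) -> avg f' <= avg g' + e.
  by move=> h; rewrite -[X in _ <= _ + X]avg_cst -avgD; apply: le_avg.
move=> fg; rewrite ler_distl lerBlDr; apply/andP; split; apply: half => u Pu;
  by have := fg u Pu; rewrite ler_distl lerBlDr => /andP[].
Qed.

End Average.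

(** * Averages for a dominant real term plus unit vectors *)

Section UnitVectors.
Variables (R : realType) (T : finType) (P : pred T) (I : finType) (i0 : I).
Hypothesis P_gt0 : (0 < #|P|)%N.
Variables (c s : I -> T -> R).
Hypothesis cs_unit : forall j u, P u -> c j u ^+ 2 + s j u ^+ 2 = 1.
Hypothesis avg_c : forall j, j != i0 -> avg P (c j) = 0.
Hypothesis avg_orth : forall j k, j != i0 -> k != i0 ->
  avg P (fun u => c j u * c k u + s j u * s k u) = (j == k)%:R.

(** With [c k] and [s k] the coordinates of the rotated unit terms, [alpha + C u] and [D u] are
    those of the rotated twisted sum, whose modulus is [m u]. *)
Let C u := \sum_(k | k != i0) c k u.
Let D u := \sum_(k | k != i0) s k u.

Hypothesis avg_Cc : forall j, j != i0 -> avg P (fun u => C u * c j u) <= 1.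

Variables (p rho alpha : R) (m : T -> R).
Hypothesis rhoE : rho = #|I|%:R.

Hypothesis p_gt1 : 1 < p.
Hypothesis p_lt2 : p < 2.
Hypothesis alpha_ge : 8 * rho <= alpha.
Hypothesis m_ge0 : forall u, P u -> 0 <= m u.
Hypothesis m_sqr : forall u, P u -> m u ^+ 2 = (alpha + C u) ^+ 2 + D u ^+ 2.

Let rho_ge1 : 1 <= rho.
Proof. by rewrite rhoE ler1n; apply/card_gt0P; exists i0. Qed.

Let alpha_gt0 : 0 < alpha.
Proof. by have := rho_ge1; have := alpha_ge; lra. Qed.

Let le_c j u : P u -> `|c j u| <= 1.
Proof.
move=> Pu; have := cs_unit j Pu; have := sqr_ge0 (s j u) => h1 h2.
by rewrite ler_norml; apply/andP; split; nra.
Qed.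

Let le_s j u : P u -> `|s j u| <= 1.
Proof.
move=> Pu; have := cs_unit j Pu; have := sqr_ge0 (c j u) => h1 h2.
by rewrite ler_norml; apply/andP; split; nra.
Qed.

Let sum_le (f : I -> R) : (forall j, `|f j| <= 1) ->
  `|\sum_(k | k != i0) f k| <= rho.
Proof.
move=> f1; apply: le_trans (ler_norm_sum _ _ _) _.
apply: (@le_trans _ _ (\sum_(k | k != i0) 1)); first exact: ler_sum.
by rewrite sumr_const rhoE ler_nat max_card.
Qed.

Let le_C u : P u -> `|C u| <= rho.
Proof. by move=> Pu; apply: sum_le => j; apply: le_c. Qed.

Let le_D u : P u -> `|D u| <= rho.
Proof. by move=> Pu; apply: sum_le => j; apply: le_s. Qed.

Let A_gt0 u : P u -> 0 < alpha + C u.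
Proof.
have := rho_ge1; have := alpha_ge => h1 h2.
by move=> /le_C; rewrite ler_norml => /andP[]; lra.
Qed.

(** The real part [alpha + C u] is already positive, since [|C u| <= rho] and [alpha >= 8 * rho]. *)
Lemma unit_modulus_gt0 u : P u -> 0 < m u.
Proof.
move=> Pu; rewrite lt_neqAle m_ge0 // andbT eq_sym -sqrf_eq0 m_sqr //.
by rewrite gt_eqF // ltr_pwDl ?sqr_ge0 // exprn_gt0 ?A_gt0.
Qed.

Lemma avg_main_gt0 : 0 < avg P (fun u => m u `^ (p - 2) * (alpha + C u)).
Proof.
apply: avg_gt0 => // u Pu; rewrite mulr_gt0 ?A_gt0 //.
by rewrite powR_gt0 ?unit_modulus_gt0.
Qed.

(* As [p < 2] and [m u >= alpha + C u], the integrand is at most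
   [(alpha + C u) `^ (p - 1)], which lies below the tangent at [alpha] of a
   concave function; the linear term averages out. *)
Lemma avg_main_le :
  avg P (fun u => m u `^ (p - 2) * (alpha + C u)) <= alpha `^ (p - 1).
Proof.
have := p_gt1; have := p_lt2 => p2 p1.
pose g u := alpha `^ (p - 1) + alpha `^ (p - 1) * ((p - 1) / alpha) * C u.
have -> : alpha `^ (p - 1) = avg P g.
  rewrite /g avgD avg_cst // avgZ /C avg_sum big1 ?mulr0 ?addr0 //.
apply: le_avg => u Pu; have A0 := A_gt0 Pu; have m0 := unit_modulus_gt0 Pu.
have Am : alpha + C u <= m u.
  by rewrite -ler_sqr ?nnegrE ?(ltW A0) ?(ltW m0) // m_sqr // lerDl sqr_ge0.
apply: (@le_trans _ _ ((alpha + C u) `^ (p - 1))).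
  have -> : p - 1 = (p - 2) + 1 by ring.
  rewrite [leRHS]powRD; last by rewrite (gt_eqF A0) implybT.
  rewrite powRr1 ?(ltW A0) // ler_wpM2r ?(ltW A0) //.
  have -> : p - 2 = - (2 - p) by ring.
  rewrite !powRN lef_pV2 ?posrE ?powR_gt0 //.
  by rewrite ge0_ler_powR ?nnegrE ?(ltW A0) ?(ltW m0) //; lra.
have -> : alpha + C u = alpha * ((alpha + C u) / alpha) by field; rewrite gt_eqF.
have B0 := divr_gt0 A0 alpha_gt0.
rewrite powRM ?(ltW alpha_gt0) ?(ltW B0) //.
have -> : g u = alpha `^ (p - 1) * (1 + (p - 1) * ((alpha + C u) / alpha - 1)).
  by rewrite /g; field; rewrite gt_eqF.
rewrite ler_wpM2l ?powR_ge0 // powR_le_tangent //; lra.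
Qed.

Lemma avg_side_expansion j : j != i0 ->
  `|avg P (fun u => m u `^ (p - 2) *
                   (c j u * (alpha + C u) + s j u * D u)) / alpha `^ (p - 2)
    - (1 + (p - 2) * avg P (fun u => C u * c j u))| <= 16 * rho ^+ 2 / alpha.
Proof.
have := p_gt1; have := p_lt2; have := rho_ge1; have := alpha_ge => ar r1 p2 p1.
(* [h] is the inner product of the [j]-th vector with the sum of all vectors of index other than
   [i0]; orthogonality leaves only the term [k = j]. *)
move=> j0; set h := fun u => c j u * C u + s j u * D u.
have avg_h : avg P h = 1.
  rewrite (_ : avg P h = avg P (fun u => \sum_(k | k != i0)
      (c j u * c k u + s j u * s k u))).
    rewrite avg_sum (bigD1 j) //= avg_orth // eqxx big1 ?addr0 // => k.
    by move=> /andP[k0 kj]; rewrite avg_orth // eq_sym (negbTE kj).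
  by apply: eq_avg => u _; rewrite /h /C /D !mulr_sumr big_split.
have -> : 1 + (p - 2) * avg P (fun u => C u * c j u) =
    avg P (fun u => alpha * c j u + (h u + (p - 2) * (C u * c j u))).
  by rewrite avgD avgD !avgZ avg_h avg_c // mulr0 add0r.
rewrite mulrC -avgZ; apply: avg_dist => // u Pu.
set e := rho / alpha; set x := C u / alpha; set z := D u / alpha.
have m0 := unit_modulus_gt0 Pu.
have e0 : 0 <= e <= 1 / 8.
  by rewrite /e divr_ge0 ?(ltW alpha_gt0) //= ?ler_pdivrMr //; lra.
have div_le y : `|y| <= rho -> `|y / alpha| <= e.
  by move=> h1; rewrite normrM normfV (gtr0_norm alpha_gt0) ler_pM2r // invr_gt0.
have xe : `|x| <= e by apply/div_le/le_C.
have ze : `|z| <= e by apply/div_le/le_D.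
have := @norm_powR_expansion _ (p / 2 - 1) x z e (m u / alpha) ltac:(lra) e0 xe ze.
have -> : 2 * (p / 2 - 1) = p - 2 by field.
have -> : (m u / alpha) `^ (p - 2) = (alpha `^ (p - 2))^-1 * m u `^ (p - 2).
  rewrite powRM ?(ltW m0) ?invr_ge0 ?(ltW alpha_gt0) // mulrC.
  rewrite -powR_inv1 ?(ltW alpha_gt0) // -powRrM [_ * (p - 2)]mulrC powRrM.
  by rewrite powR_inv1 ?powR_ge0.
move=> /(_ (divr_ge0 (ltW m0) (ltW alpha_gt0))).
rewrite mulrA; set f := _ * m u `^ _.
have -> : (m u / alpha) ^+ 2 = (1 + x) ^+ 2 + z ^+ 2.
  by rewrite expr_div_n m_sqr // /x /z; field; rewrite gt_eqF.
move=> /(_ erefl) fe.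
have Cx : C u = alpha * x by rewrite /x mulrC divfK // gt_eqF.
have Dz : D u = alpha * z by rewrite /z mulrC divfK // gt_eqF.
have re : rho = alpha * e by rewrite /e mulrC divfK // gt_eqF.
have -> : 16 * rho ^+ 2 / alpha = alpha * (16 * e ^+ 2).
  by rewrite re; field; rewrite gt_eqF.
(* The error splits in two: the second-order remainder of [f] against [c j], of size [10 * e ^+ 2],
   and [f - 1] against a term of order [e], of size [3 * e * (2 * e)]. *)
have -> : f * (c j u * (alpha + C u) + s j u * D u) -
    (alpha * c j u + (h u + (p - 2) * (C u * c j u))) =
    alpha * ((f - (1 + (p - 2) * x)) * c j u
             + (f - 1) * (c j u * x + s j u * z)).
  by rewrite /h Cx Dz; ring.
rewrite normrM (gtr0_norm alpha_gt0) ler_pM2l //.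
apply: le_trans (ler_normD _ _) _; rewrite !normrM.
have cj := le_c j Pu; have sj := le_s j Pu.
have f1 : `|f - 1| <= 3 * e.
  have -> : f - 1 = (f - (1 + (p - 2) * x)) + (p - 2) * x by ring.
  apply: le_trans (ler_normD _ _) _; rewrite normrM (ler0_norm (x := p - 2)); nra.
have cz : `|c j u * x + s j u * z| <= 2 * e.
  apply: le_trans (ler_normD _ _) _; rewrite (normrM (c j u)) (normrM (s j u)).
  have h1 := ler_pM (normr_ge0 _) (normr_ge0 _) cj xe.
  have h2 := ler_pM (normr_ge0 _) (normr_ge0 _) sj ze.
  by apply: le_trans (lerD h1 h2) _; lra.
have t1 := ler_pM (normr_ge0 _) (normr_ge0 _) fe cj.
have t2 := ler_pM (normr_ge0 _) (normr_ge0 _) f1 cz.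
by apply: le_trans (lerD t1 t2) _; lra.
Qed.

Lemma avg_side_bounds j : j != i0 ->
  16 * rho ^+ 2 / alpha < p - 1 -> alpha `^ (p - 2) * (2 + rho) < 1 ->
  0 < avg P (fun u => m u `^ (p - 2) *
                   (c j u * (alpha + C u) + s j u * D u)) < 1.
Proof.
have := p_gt1; have := p_lt2; have := rho_ge1; have := alpha_gt0 => a0 r1 p2 p1.
move=> j0 small1 small2; have := avg_side_expansion j0.
have := avg_Cc j0; set E := avg P _ => E1; set X := avg P _.
have E2 : - rho <= E.
  rewrite -[- rho](avg_cst P_gt0); apply: le_avg => u Pu.
  have := ler_pM (normr_ge0 _) (normr_ge0 _) (le_C Pu) (le_c j Pu).
  by rewrite -normrM mulr1 ler_norml => /andP[].
have ap0 : 0 < alpha `^ (p - 2) by rewrite powR_gt0.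
rewrite ler_distl => /andP[lo up].
have Xlo : 0 < X / alpha `^ (p - 2).
  have h : 0 <= (2 - p) * (1 - E) by apply: mulr_ge0; lra.
  by apply: lt_le_trans lo; lra.
have Xup : X / alpha `^ (p - 2) <= 2 + rho.
  have h : 0 <= (2 - p) * (E + rho) by apply: mulr_ge0; lra.
  have h' : 0 <= (p - 1) * rho by apply: mulr_ge0; lra.
  by apply: le_trans up _; lra.
rewrite pmulr_lgt0 ?invr_gt0 // in Xlo.
by rewrite Xlo /=; rewrite ler_pdivrMr // in Xup; lra.
Qed.

End UnitVectors.

(** * Orthogonality over the units modulo [d] *)

Lemma sum_units_eq0 (K : idomainType) (d : nat) (f : nat -> K) (a : nat) :
  (0 < d)%N -> {morph f : m n / (m * n)%N >-> m * n} ->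
  (forall n, f (n %% d)%N = f n) -> coprime a d -> f a != 1 ->
  \sum_(u < d | coprime u d) f u = 0.
Proof.
move=> d_gt0 fM f_mod cad fa1; set S := \sum_(u < d | _) _.
(* Multiplication by [a] permutes the residues and preserves the units, so [f a * S = S] with
   [f a != 1]. *)
pose h (u : 'I_d) := Ordinal (ltn_pmod (a * u) d_gt0).
have h_inj : injective h.
  move=> u v /(congr1 val) /= /eqP; wlog uv : u v / (u <= v)%N.
    by move=> hw; case/orP: (leq_total u v) => uv e; [|apply/esym]; apply: hw;
       rewrite // eq_sym.
  rewrite eq_sym eqn_mod_dvd ?leq_mul // -mulnBr Gauss_dvdr 1?coprime_sym //.
  rewrite -eqn_mod_dvd // !modn_small ?ltn_ord // => /eqP e.
  exact/val_inj.
have : f a * S = S.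
  rewrite [RHS](reindex_inj h_inj) /= mulr_sumr; apply: eq_big => u.
    by rewrite coprime_modl coprimeMl cad.
  by move=> _; rewrite f_mod fM.
move/eqP; rewrite -subr_eq0 -[X in _ - X]mul1r -mulrBl mulf_eq0 subr_eq0.
by rewrite (negbTE fa1) => /eqP.
Qed.

Lemma card_coprime (d : nat) :
  #|(fun u : 'I_d => coprime u d)| = totient d.
Proof.
rewrite totient_count_coprime -sum1_card [LHS]big_mkcond big_mkord /=.
by apply: eq_bigr => u _; rewrite coprime_sym unfold_in; case: coprime.
Qed.

Section Orthogonality.
Variables (R : realType) (d : nat).
Hypothesis d_gt0 : (0 < d)%N.
Implicit Types chi : dirichlet_char R.

Lemma dchar_modn chi (n : nat) :
  (modulus chi %| d)%N -> chi (n %% d)%N%:Z = chi n%:Z.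
Proof.
move=> md; apply/esym/dchar_congr; rewrite [X in X%:Z - _](divn_eq n d) PoszD addrK.
exact: dvdn_mull.
Qed.

Lemma inequiv_neq chi1 chi2 :
  (modulus chi1 %| d)%N -> (modulus chi2 %| d)%N -> ~ equivalent_chars chi1 chi2 ->
  exists2 a : nat, coprime a d & chi1 a%:Z != chi2 a%:Z.
Proof.
move=> m1 m2 ne; apply: contrapT => h; apply: ne.
apply: (equivalent_charsP d_gt0 m1 m2) => n cn; apply/eqP/negPn/negP => e.
by apply: h; exists n.
Qed.

Lemma dchar_unit chi (u : nat) : (modulus chi %| d)%N -> coprime u d ->
  (chi u%:Z)^*%C * chi u%:Z = 1.
Proof.
move=> md cu; rewrite mulrC -sqr_normc norm_dchar ?expr1n //.
exact: coprime_dvdr md cu.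
Qed.

Lemma dchar_orth chi1 chi2 :
  (modulus chi1 %| d)%N -> (modulus chi2 %| d)%N -> ~ equivalent_chars chi1 chi2 ->
  \sum_(u < d | coprime u d) (chi1 u%:Z)^*%C * chi2 u%:Z = 0.
Proof.
move=> m1 m2 ne; have [a ca e] := inequiv_neq m1 m2 ne.
apply: (@sum_units_eq0 _ d (fun u => (chi1 u%:Z)^*%C * chi2 u%:Z) a) => //.
- by move=> m n; rewrite PoszM !dcharM rmorphM mulrACA.
- by move=> n; rewrite !dchar_modn.
apply: contra e => /eqP e; rewrite -[chi1 _]mulr1 -e mulrA [chi1 _ * _]mulrC.
by rewrite dchar_unit // mul1r.
Qed.

(** At a unit [a] where [chi1] and [chi2] differ, the two products cannot both equal 1; one whose
    value at [a] is not 1 has a vanishing sum. *)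
Lemma dchar_sqr_orth chi0 chi chi1 chi2 :
  (modulus chi0 %| d)%N -> (modulus chi %| d)%N ->
  (modulus chi1 %| d)%N -> (modulus chi2 %| d)%N -> ~ equivalent_chars chi1 chi2 ->
  \sum_(u < d | coprime u d) (chi0 u%:Z)^*%C ^+ 2 * chi u%:Z * chi1 u%:Z = 0 \/
  \sum_(u < d | coprime u d) (chi0 u%:Z)^*%C ^+ 2 * chi u%:Z * chi2 u%:Z = 0.
Proof.
move=> m0 m m1 m2 ne; have [a ca e] := inequiv_neq m1 m2 ne.
pose f psi (n : nat) := (chi0 n%:Z)^*%C ^+ 2 * chi n%:Z * psi n%:Z.
have f0 psi : (modulus psi %| d)%N -> f psi a != 1 ->
    \sum_(u < d | coprime u d) f psi u = 0.
  move=> mp; apply: (@sum_units_eq0 _ d (f psi)) => //.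
  - by move=> x y; rewrite /f PoszM !dcharM rmorphM /=; ring.
  - by move=> n; rewrite /f !dchar_modn.
have [f1|f1] := eqVneq (f chi1 a) 1; last by left; apply: f0.
have [f2|f2] := eqVneq (f chi2 a) 1; last by right; apply: f0.
have fa : (chi0 a%:Z)^*%C ^+ 2 * chi a%:Z != 0.
  by apply/eqP => h; move/eqP: f1; rewrite /f h mul0r eq_sym oner_eq0.
by case/eqP: e; apply: (mulfI fa); rewrite -[LHS]/(f chi1 a) f1 -f2.
Qed.

End Orthogonality.

Lemma sum_le1_of_one_term (R : realType) (I : finType) (Q : pred I) (B : I -> R) :
  (forall k, Q k -> B k <= 1) ->
  (forall k l, Q k -> Q l -> k != l -> B k = 0 \/ B l = 0) ->
  \sum_(k | Q k) B k <= 1.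
Proof.
move=> B1 B0; have [[k Qk Bk]|h] := pselect (exists2 k, Q k & B k != 0).
  rewrite (bigD1 k) //= big1 ?addr0 ?B1 // => l /andP[Ql lk].
  by have [//|e] := B0 _ _ Ql Qk lk; rewrite e eqxx in Bk.
rewrite big1 ?ler01 // => k Qk; apply/eqP/negPn/negP => Bk.
by apply: h; exists k.
Qed.

(** * Real and imaginary parts, and the modulus *)

Section ReIm.
Variable R : rcfType.
Implicit Types x y z : R[i].

Lemma ReD x y : complex.Re (x + y) = complex.Re x + complex.Re y.
Proof. by case: x y => [a b] [a' b']. Qed.

Lemma ImD x y : complex.Im (x + y) = complex.Im x + complex.Im y.
Proof. by case: x y => [a b] [a' b']. Qed.

Lemma Re_sum (J : Type) (s : seq J) (Q : pred J) (F : J -> R[i]) :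
  complex.Re (\sum_(j <- s | Q j) F j) = \sum_(j <- s | Q j) complex.Re (F j).
Proof. exact: (big_morph _ ReD). Qed.

Lemma Im_sum (J : Type) (s : seq J) (Q : pred J) (F : J -> R[i]) :
  complex.Im (\sum_(j <- s | Q j) F j) = \sum_(j <- s | Q j) complex.Im (F j).
Proof. exact: (big_morph _ ImD). Qed.

Lemma Re_mul x y :
  complex.Re (x * y) = complex.Re x * complex.Re y - complex.Im x * complex.Im y.
Proof. by case: x y => [a b] [a' b']. Qed.

Lemma Re_conj_mul x y : complex.Re (x^*%C * y) =
  complex.Re x * complex.Re y + complex.Im x * complex.Im y.
Proof. by case: x y => [a b] [a' b'] /=; rewrite mulNr opprK. Qed.

End ReIm.

Lemma cmod_sqr (R : realType) (z : R[i]) :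
  cmod z ^+ 2 = complex.Re z ^+ 2 + complex.Im z ^+ 2.
Proof. by rewrite /cmod normc_def /= sqr_sqrtr // addr_ge0 ?sqr_ge0. Qed.

Lemma cmod_ge0 (R : realType) (z : R[i]) : 0 <= cmod z.
Proof. by rewrite /cmod normc_def sqrtr_ge0. Qed.

(** * The twisted sum rotated by its leading term *)

Section Twisted.
Variables (R : realType) (r d : nat) (chi : 'I_r -> dirichlet_char R).
Variables (theta : 'I_r -> R) (i0 : 'I_r).
Hypothesis d_gt0 : (0 < d)%N.
Hypothesis modulus_dvd : forall j, (modulus (chi j) %| d)%N.
Hypothesis inequiv : forall j k, j != k -> ~ equivalent_chars (chi j) (chi k).

Let P (u : 'I_d) := coprime u d.
Let a j (u : 'I_d) := expNi (theta j) * chi j u%:Z.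
Let w j u := (a i0 u)^*%C * a j u.
Let c j u := complex.Re (w j u).
Let s j u := complex.Im (w j u).

Lemma card_units_gt0 : (0 < #|P|)%N.
Proof. by rewrite card_coprime totient_gt0. Qed.

Lemma expNi_unit (t : R) : (expNi t)^*%C * expNi t = 1.
Proof.
apply/eqP; rewrite eq_complex /= opprK; apply/andP; split; apply/eqP.
  by rewrite mulrN opprK -!expr2 cos2Dsin2.
ring.
Qed.

Lemma twist_unit j u : P u -> (a j u)^*%C * a j u = 1.
Proof. by move=> Pu; rewrite rmorphM mulrACA expNi_unit (dchar_unit (modulus_dvd j) Pu) mulr1. Qed.

Lemma ratio_unit j u : P u -> (w j u)^*%C * w j u = 1.
Proof.
move=> Pu; rewrite rmorphM /= conjcK mulrACA twist_unit // mulr1.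
by rewrite mulrC twist_unit.
Qed.

Lemma ratio_sqr_sum j u : P u -> c j u ^+ 2 + s j u ^+ 2 = 1.
Proof. by move=> Pu; rewrite !expr2 -Re_conj_mul ratio_unit. Qed.

Lemma avg_Re (g : 'I_d -> R[i]) :
  \sum_(u | P u) g u = 0 -> avg P (fun u => complex.Re (g u)) = 0.
Proof. by move=> g0; rewrite /avg -Re_sum g0 mulr0. Qed.

Lemma avg_ratio j : j != i0 -> avg P (c j) = 0.
Proof.
move=> j0; apply: avg_Re.
rewrite (eq_bigr (fun u : 'I_d => (expNi (theta i0))^*%C * expNi (theta j) *
   ((chi i0 u%:Z)^*%C * chi j u%:Z))); last first.
  by move=> u _; rewrite /w /a rmorphM /= mulrACA.
by rewrite -mulr_sumr dchar_orth ?mulr0 //; apply: inequiv; rewrite eq_sym.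
Qed.

(** The rotation cancels in the product of the conjugate of [w j] with [w k], which leaves a
    constant times [(chi j)^* * chi k]. *)
Lemma avg_ratio_orth j k :
  avg P (fun u => c j u * c k u + s j u * s k u) = (j == k)%:R.
Proof.
rewrite (@eq_avg _ _ _ _ (fun u => complex.Re ((a j u)^*%C * a k u))); last first.
  move=> u Pu; rewrite -Re_conj_mul /w rmorphM /= conjcK mulrACA [a i0 u * _]mulrC.
  by rewrite twist_unit // mul1r.
have [<-|jk] := eqVneq j k.
  rewrite (@eq_avg _ _ _ _ (fun=> 1)) ?avg_cst ?card_units_gt0 // => u Pu.
  by rewrite twist_unit.
apply: avg_Re.
rewrite (eq_bigr (fun u : 'I_d => (expNi (theta j))^*%C * expNi (theta k) *
   ((chi j u%:Z)^*%C * chi k u%:Z))); last first.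
  by move=> u _; rewrite /a rmorphM /= mulrACA.
by rewrite -mulr_sumr dchar_orth ?mulr0 //; apply: inequiv.
Qed.

(* [2 Re z Re z' = Re (z z') + Re (conj z z')]: the second part averages to the
   Kronecker delta, and the first one is nonzero for at most one index [k],
   that with [chi k * chi j] equivalent to [chi i0 ^+ 2]. *)
Lemma avg_ratio_sum_le j : j != i0 ->
  avg P (fun u => (\sum_(k | k != i0) c k u) * c j u) <= 1.
Proof.
move=> j0; pose B k := avg P (fun u => complex.Re (w k u * w j u)).
have -> : avg P (fun u => (\sum_(k | k != i0) c k u) * c j u) =
    2^-1 * (\sum_(k | k != i0) B k + 1).
  have e1 : \sum_(k | k != i0) (k == j)%:R = 1 :> R.
    by rewrite (bigD1 j) //= eqxx big1 ?addr0 // => k /andP[_ /negbTE ->].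
  rewrite -[X in _ + X]e1 -big_split mulr_sumr /=.
  under [RHS]eq_bigr do rewrite -avg_ratio_orth -avgD -avgZ.
  rewrite -avg_sum; apply: eq_avg => u Pu; rewrite mulr_suml.
  apply: eq_bigr => k _; rewrite Re_mul.
  by rewrite -/(c k u) -/(c j u) -/(s k u) -/(s j u); field.
suff : \sum_(k | k != i0) B k <= 1 by lra.
apply: sum_le1_of_one_term => [k k0|k l k0 l0 kl].
  rewrite -[1](avg_cst card_units_gt0); apply: le_avg => u Pu.
  have := ratio_sqr_sum k Pu; have := ratio_sqr_sum j Pu.
  rewrite Re_mul -/(c k u) -/(c j u) -/(s k u) -/(s j u) => h1 h2.
  (* For unit vectors these two squares add up to [2 - 2 * Re (w k u * w j u)]. *)
  have := sqr_ge0 (c k u - c j u); have := sqr_ge0 (s k u + s j u); nra.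
have B0 m : \sum_(u < d | coprime u d)
      (chi i0 u%:Z)^*%C ^+ 2 * chi j u%:Z * chi m u%:Z = 0 -> B m = 0.
  move=> e; apply: avg_Re.
  rewrite (eq_bigr (fun u : 'I_d => (expNi (theta i0))^*%C ^+ 2 * expNi (theta j) *
      expNi (theta m) * ((chi i0 u%:Z)^*%C ^+ 2 * chi j u%:Z * chi m u%:Z))).
    by rewrite -mulr_sumr e mulr0.
  by move=> u _; rewrite /w /a rmorphM /=; ring.
by have [e|e] := dchar_sqr_orth d_gt0 (modulus_dvd i0) (modulus_dvd j)
  (modulus_dvd k) (modulus_dvd l) (inequiv kl); [left|right]; apply: B0.
Qed.

Variable alpha : R.
Hypothesis i0_val : val i0 = 0%N.

Let S (u : 'I_d) := twisted_sum chi theta (alpha_vec alpha) u%:Z.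
Let C u := \sum_(k | k != i0) c k u.
Let D u := \sum_(k | k != i0) s k u.

Lemma twisted_sum_rot u : P u ->
  (a i0 u)^*%C * S u = alpha%:C%C + \sum_(k | k != i0) w k u.
Proof.
move=> Pu; rewrite /S /twisted_sum mulr_sumr (bigD1 i0) //=; congr (_ + _).
  by rewrite -mulrA mulrCA -/(a i0 u) twist_unit // mulr1 /alpha_vec i0_val eqxx.
apply: eq_bigr => k k0; rewrite /alpha_vec.
have /negbTE -> : val k != 0%N.
  by apply: contra k0 => /eqP e; apply/eqP/val_inj; rewrite e i0_val.
by rewrite mul1r.
Qed.

Lemma Re_twisted_sum_rot u : P u -> complex.Re ((a i0 u)^*%C * S u) = alpha + C u.
Proof. by move=> Pu; rewrite twisted_sum_rot // ReD Re_sum. Qed.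

Lemma Im_twisted_sum_rot u : P u -> complex.Im ((a i0 u)^*%C * S u) = D u.
Proof. by move=> Pu; rewrite twisted_sum_rot // ImD Im_sum add0r. Qed.

Lemma cmod_twisted_sum u : P u -> cmod (S u) ^+ 2 = (alpha + C u) ^+ 2 + D u ^+ 2.
Proof.
move=> Pu; rewrite -Re_twisted_sum_rot // -Im_twisted_sum_rot // -cmod_sqr.
suff n1 : `|(a i0 u)^*%C| = 1 by rewrite /cmod normrM n1 mul1r.
apply/eqP; rewrite normcJ -sqrp_eq1 // sqr_normc mulrC twist_unit //.
Qed.

(** Inserting [a i0 u * (a i0 u)^* = 1] turns the product into the conjugate of [w j u] times the
    rotated sum. *)
Lemma Re_conj_twisted_sum j u : P u ->
  complex.Re ((a j u)^*%C * S u) = c j u * (alpha + C u) + s j u * D u.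
Proof.
move=> Pu; rewrite -Re_twisted_sum_rot // -Im_twisted_sum_rot // -Re_conj_mul.
rewrite /w [in RHS]rmorphM /= conjcK [in RHS]mulrACA [a i0 u * _]mulrC twist_unit // mul1r.
by [].
Qed.

End Twisted.

(** * The least common multiple of the moduli *)

Section LcmModuli.
Variables (R : realType) (r : nat) (chi : 'I_r -> dirichlet_char R).

Lemma lcm_moduli_gt0 : (0 < lcm_moduli chi)%N.
Proof.
apply: (big_ind (fun n => 0 < n)%N) => // [m n m0 n0|j _].
  by rewrite lcmn_gt0 m0.
exact: modulus_gt0.
Qed.

Lemma dvdn_lcm_moduli j : (modulus (chi j) %| lcm_moduli chi)%N.
Proof. exact: (biglcmn_sup j). Qed.

End LcmModuli.

(** * The threshold and the final comparison *)

Lemma powR_lt_self (R : realType) (x q : R) : 0 < x < 1 -> 1 < q -> x `^ q < x.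
Proof.
move=> /andP[x0 x1] q1; rewrite -mulr_powRB1 ?(ltW x0) //; last by lra.
rewrite gtr_pMr // [ltRHS](_ : 1 = 1 `^ (q - 1)); last by rewrite powR1.
by rewrite gt0_ltr_powR ?nnegrE ?(ltW x0) //; lra.
Qed.

Theorem theorem5 (R : realType) (sigma : R) (r : nat)
    (sigma_gt : 1 / 2 < sigma) (sigma_lt : sigma < 1) (r_ge2 : (2 <= r)%N) :
  exists2 alpha0 : R, 0 < alpha0 &
    forall (theta : 'I_r -> R) (chi : 'I_r -> dirichlet_char R),
      (forall j k : 'I_r, j != k -> ~ equivalent_chars (chi j) (chi k)) ->
    forall alpha : R, alpha0 <= alpha ->
      (forall j : 'I_r, 0 < Xi sigma chi theta (alpha_vec alpha) j) /\
      \sum_(j < r) Xi sigma chi theta (alpha_vec alpha) j `^ (1 / (1 - sigma))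
        < xi sigma chi theta (alpha_vec alpha).
Proof.
pose p := 1 / sigma; pose rho : R := r%:R.
have sigma0 : 0 < sigma by lra.
have p_gt1 : 1 < p by rewrite /p ltr_pdivlMr //; lra.
have p_lt2 : p < 2 by rewrite /p ltr_pdivrMr //; lra.
have rho0 : 0 <= rho by rewrite ler0n.
pose K1 := 16 * rho ^+ 2 / (p - 1); pose K2 := (2 + rho) `^ (1 / (2 - p)).
have K1_ge0 : 0 <= K1.
  by rewrite divr_ge0 ?mulr_ge0 ?sqr_ge0 ?ler0n // subr_ge0 ltW.
have K2_gt0 : 0 < K2 by rewrite powR_gt0 //; lra.
exists (1 + 8 * rho + K1 + K2); first by lra.
move=> theta chi inequiv alpha alpha_ge.
have alpha0 : 0 < alpha by lra.
have alpha_rho : 8 * rho <= alpha by lra.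
have small1 : 16 * rho ^+ 2 / alpha < p - 1.
  rewrite ltr_pdivrMr // [ltRHS]mulrC -ltr_pdivrMr ?subr_gt0 // -/K1; lra.
have small2 : alpha `^ (p - 2) * (2 + rho) < 1.
  have -> : p - 2 = - (2 - p) by ring.
  rewrite powRN mulrC ltr_pdivrMr ?powR_gt0 // mul1r.
  have {1}-> : 2 + rho = K2 `^ (2 - p).
    by rewrite /K2 -powRrM divfK ?gt_eqF ?subr_gt0 // powRr1 // addr_ge0.
  by rewrite gt0_ltr_powR ?nnegrE ?(ltW K2_gt0) ?(ltW alpha0) //; lra.
set d := lcm_moduli chi.
have d_gt0 : (0 < d)%N := lcm_moduli_gt0 chi.
have m_dvd j : (modulus (chi j) %| d)%N := dvdn_lcm_moduli chi j.
pose i0 : 'I_r := Ordinal (ltnW r_ge2).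
pose P (u : 'I_d) := coprime u d.
pose m (u : 'I_d) := cmod (twisted_sum chi theta (alpha_vec alpha) u%:Z).
pose w j (u : 'I_d) := (expNi (theta i0) * chi i0 u%:Z)^*%C *
                       (expNi (theta j) * chi j u%:Z).
pose c j u := complex.Re (w j u); pose s j u := complex.Im (w j u).
pose C u := \sum_(k | k != i0) c k u; pose D u := \sum_(k | k != i0) s k u.
have P_gt0 : (0 < #|P|)%N := card_units_gt0 d_gt0.
have rhoE : rho = #|'I_r|%:R by rewrite card_ord.
have cs1 j u : P u -> c j u ^+ 2 + s j u ^+ 2 = 1.
  by move=> Pu; apply: ratio_sqr_sum.
have avg_c j : j != i0 -> avg P (c j) = 0.
  by move=> j0; apply: avg_ratio.
have orth j k : j != i0 -> k != i0 ->
    avg P (fun u => c j u * c k u + s j u * s k u) = (j == k)%:R.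
  by move=> _ _; apply: avg_ratio_orth.
have avg_Cc j : j != i0 -> avg P (fun u => C u * c j u) <= 1.
  by move=> j0; apply: avg_ratio_sum_le.
have m_ge0 u : P u -> 0 <= m u by move=> _; apply: cmod_ge0.
have m_sqr u : P u -> m u ^+ 2 = (alpha + C u) ^+ 2 + D u ^+ 2.
  by move=> Pu; apply: cmod_twisted_sum.
have m_gt0 u (Pu : P u) : 0 < m u :=
  unit_modulus_gt0 cs1 rhoE alpha_rho m_ge0 m_sqr Pu.
pose X j := Xi sigma chi theta (alpha_vec alpha) j.
have XE j : X j = avg P (fun u => m u `^ (p - 2) *
    (c j u * (alpha + C u) + s j u * D u)).
  rewrite /X /Xi /avg card_coprime -/d; congr (_ * _); apply: eq_big => u.
    (* Since [m u > 0], the starred sum runs over all units. *)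
    apply: andb_idr => Pu; apply/eqP => e.
    by have := m_gt0 u Pu; rewrite /m e /cmod normr0 ltxx.
  move=> /andP[Pu _]; congr (_ * _); exact: Re_conj_twisted_sum.
have X0E : X i0 = avg P (fun u => m u `^ (p - 2) * (alpha + C u)).
  rewrite XE; apply: eq_avg => u Pu; have w1 : w i0 u = 1 by apply: twist_unit.
  by rewrite /c /s w1 mul1r mul0r addr0.
have xiE : xi sigma chi theta (alpha_vec alpha) =
    alpha * X i0 + \sum_(j | j != i0) X j.
  transitivity (avg P (fun u => m u `^ p)).
    by rewrite /xi /avg card_coprime.
  rewrite X0E; under [X in _ + X]eq_bigr do rewrite XE.
  rewrite -avgZ -avg_sum -avgD; apply: eq_avg => u Pu.
  rewrite -mulr_sumr big_split /= -!mulr_suml -/(C u) -/(D u).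
  rewrite mulrCA -mulrDr; have -> : alpha * (alpha + C u) +
      (C u * (alpha + C u) + D u * D u) = m u ^+ 2.
    by rewrite m_sqr //; ring.
  rewrite -powR_mulrn ?m_ge0 // -powRD ?subrK //.
  by rewrite (gt_eqF (m_gt0 u Pu)) implybT.
have X0_gt0 : 0 < X i0.
  rewrite X0E; exact: (avg_main_gt0 P_gt0 cs1 p rhoE alpha_rho m_ge0 m_sqr).
have X0_le : X i0 <= alpha `^ (p - 1).
  rewrite X0E.
  exact: (avg_main_le P_gt0 cs1 avg_c rhoE p_gt1 p_lt2 alpha_rho m_ge0 m_sqr).
have Xj j : j != i0 -> 0 < X j < 1.
  move=> j0; rewrite XE.
  exact: (avg_side_bounds P_gt0 cs1 avg_c orth avg_Cc rhoE p_gt1 p_lt2 alpha_rho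
    m_ge0 m_sqr j0 small1 small2).
split=> [j|]; first by have [->|/Xj/andP[]] := eqVneq j i0.
set q := 1 / (1 - sigma); have q_gt1 : 1 < q by rewrite /q ltr_pdivlMr; lra.
(* The exponents satisfy [(p - 1) * (q - 1) = 1], so raising [X i0 <= alpha]^ (p - 1)[to the power]q
   - 1[gives]X i0 [^ (q - 1) <= alpha]. *)
have X0q : X i0 `^ q <= alpha * X i0.
  rewrite -mulr_powRB1 ?(ltW X0_gt0) //; last by lra.
  rewrite mulrC ler_wpM2r ?(ltW X0_gt0) //.
  have q1_ge0 : 0 <= q - 1 by lra.
  have := ge0_ler_powR q1_ge0 (ltW X0_gt0) (powR_ge0 _ _) X0_le.
  rewrite -powRrM (_ : (p - 1) * (q - 1) = 1) ?powRr1 ?(ltW alpha0) //.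
  by rewrite /p /q; field; rewrite subr_eq0 !gt_eqF.
rewrite xiE (bigD1 i0) //= ler_ltD //.
(* Strictness comes from the indices other than [i0]; the index 1, [Ordinal r_ge2], is one of
   them. *)
apply: ltr_sum => [|j j0]; last exact/powR_lt_self/q_gt1/Xj.
by apply/hasP; exists (Ordinal r_ge2); rewrite ?mem_index_enum.
Qed.
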